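(* Let $A_2(n;k,\ell,m)$ be the number of finite sequences $\lambda_1,\dots,\lambda_s$ of coloured positive integers with $\sum\lambda_i=n$, where odd parts are coloured $a$ or $d$, even parts are coloured $b$ or $c$, there is no part $1_d$, and $\lambda_i-\lambda_{i+1}\ge B_2(\text{colour of }\lambda_i,\text{colour of }\lambda_{i+1})$ for all $1\le i<s$, having $k$ parts coloured $a$, $\ell$ parts coloured $c$ and $m$ parts coloured $d$. Then $$\sum_{n,k,\ell,m\ge0}A_2(n;k,\ell,m)\,q^n a^k c^\ell d^m=\frac{(-aq;q^4)_\infty(-dq^3;q^4)_\infty}{(q^2;q^2)_\infty(cq^2;q^4)_\infty}.$$ In particular (setting $a=c=d=1$) the generating function of all such coloured partitions is $1/(q;q)_\infty$.
   Context: Notation: $(x;q)_\infty=\prod_{n\ge0}(1-xq^n)$. $B_2$ is the matrix with rows and columns indexed by $(a,b,c,d)$: row $a$: $(4,1,3,2)$; row $b$: $(3,0,2,1)$; row $c$: $(1,2,0,3)$; row $d$: $(2,3,1,4)$. *)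

(* Defs.v *)
From HB Require Import structures.
From mathcomp Require Import all_boot all_order all_algebra.
Set Implicit Arguments. Unset Strict Implicit. Unset Printing Implicit Defensive.
Import Order.TTheory GRing.Theory Num.Theory.

Inductive colour := Ca | Cb | Cc | Cd.

Definition colour_to_ord (x : colour) : 'I_4 :=
  match x with Ca => inord 0 | Cb => inord 1 | Cc => inord 2 | Cd => inord 3 end.
Definition ord_to_colour (i : 'I_4) : colour :=
  match val i with 0 => Ca | 1 => Cb | 2 => Cc | _ => Cd end.
Lemma colour_toK : cancel colour_to_ord ord_to_colour.
Proof. by case; rewrite /ord_to_colour /= inordK. Qed.

HB.instance Definition _ := Equality.copy colour (can_type colour_toK).
HB.instance Definition _ := Choice.copy colour (can_type colour_toK).
HB.instance Definition _ := Countable.copy colour (can_type colour_toK).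
HB.instance Definition _ := Finite.copy colour (can_type colour_toK).

Definition B2 (x y : colour) : nat :=
  match x, y with
  | Ca, Ca => 4 | Ca, Cb => 1 | Ca, Cc => 3 | Ca, Cd => 2
  | Cb, Ca => 3 | Cb, Cb => 0 | Cb, Cc => 2 | Cb, Cd => 1
  | Cc, Ca => 1 | Cc, Cb => 2 | Cc, Cc => 0 | Cc, Cd => 3
  | Cd, Ca => 2 | Cd, Cb => 3 | Cd, Cc => 1 | Cd, Cd => 4
  end.

Definition cpart := (nat * colour)%type.

Definition part_ok (p : cpart) : bool :=
  [&& 0 < p.1,
      if odd p.1 then (p.2 == Ca) || (p.2 == Cd) else (p.2 == Cb) || (p.2 == Cc)
    & p != (1, Cd)].

Definition diff_ok (p p' : cpart) : bool := (p'.1 + B2 p.2 p'.2 <= p.1)%N.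

Definition A2_seq (n k l m : nat) (s : seq cpart) : bool :=
  [&& all part_ok s, sorted diff_ok s, sumn (map fst s) == n,
      count (fun p => p.2 == Ca) s == k,
      count (fun p => p.2 == Cc) s == l
    & count (fun p => p.2 == Cd) s == m].

(* A_2(n;k,l,m): number of such sequences.  Every such sequence has length
   <= n and parts <= n, so all of them are among the n-bounded sequences of
   elements of 'I_(n.+1) * colour, a finite type. *)
Definition A2 (n k l m : nat) : nat :=
  #|[set s : {bseq n of ('I_n.+1 * colour)%type} |
      A2_seq n k l m [seq (val x.1, x.2) | x <- (s : seq _)]]|.

Local Open Scope ring_scope.

(* Coefficient ring Z[a,c,d] realised as nested polynomials:
   innermost variable a, then c, then d; the series variable q is outermost. *)
Definition Ra := {poly int}.
Definition Rc := {poly Ra}.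
Definition Rd := {poly Rc}.
Definition Rq := {poly Rd}.

Definition va : Rd := ('X : Ra)%:P%:P.
Definition vc : Rd := ('X : Rc)%:P.
Definition vd : Rd := ('X : Rd).

(* Truncation at level N of the right-hand side
     (-aq;q^4)_oo (-dq^3;q^4)_oo / ((q^2;q^2)_oo (cq^2;q^4)_oo),
   with 1/(1-x) expanded as the geometric series sum_i x^i (the inverse in
   the formal power series ring).  For N >= n the q^n-coefficient of the
   truncation is the q^n-coefficient of the formal power series. *)
Definition rhs_trunc (N : nat) : Rq :=
  (\prod_(j < N) (1 + va *: 'X^(4 * j + 1)))
  * (\prod_(j < N) (1 + vd *: 'X^(4 * j + 3)))
  * (\prod_(j < N) \sum_(i < N.+1) 'X^(2 * j.+1 * i))
  * (\prod_(j < N) \sum_(i < N.+1) (vc ^+ i) *: 'X^((4 * j + 2) * i)).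

Definition coef4 (P : Rq) (n k l m : nat) : int := (P`_n)`_m`_l`_k.

(* Main.v *)
Require Import Defs.
From HB Require Import structures.
From mathcomp Require Import all_boot all_order all_algebra.
From mathcomp Require Import zify ring.
Set Implicit Arguments. Unset Strict Implicit. Unset Printing Implicit Defensive.
Import GRing.Theory.
Local Open Scope ring_scope.

(** Grade the parts by levels: at level [j >= 0] the parts are [(2j+1)_a],
    [(2j+2)_b], [(2j+2)_c] and [(2j+3)_d]; with [q := x^2], [A := a x] and
    [D := d x^3] their weights are [A q^j], [q^(j+1)], [c q^(j+1)] and [D q^j],
    and the difference conditions only compare neighbouring levels.  Let [g k] be
    the generating function of the sequences using only the first [k] levels.
    Conditioning on the largest part gives linear recurrences for
    [(q;q)_k (cq;q)_k g k], whose solution is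
    [[
      G_k(A,D) = sum_s q^(s^2-s) (q;q)_(k+1) / ((q^2;q^2)_s (q;q)_(k+1-2s))
                       (cq^2;q^2)_(k-s) T_s(A,D)
    ]]
    with [T_s] polynomials symmetric in [A] and [D].  For [k] beyond the truncation
    order the recurrences force [G(A,D) = (1+A) G(Aq^2,D)]; iterating in [A] and,
    by symmetry, in [D] yields [(-A;q^2)_oo (-D;q^2)_oo (cq^2;q^2)_oo].  Truncated
    power series are handled in an arbitrary commutative ring where [x] is
    nilpotent, instantiated at the end by polynomials modulo ['X^(n+1)]. *)

(** * The coefficients K(n,s) and the symmetric polynomials T_s *)

Section Coefficients.
Variables (R : comNzRingType) (q : R).

(* (q;q)_n / ((q^2;q^2)_s (q;q)_(n-2s)), and 0 when n < 2s. *)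
Fixpoint qK (n s : nat) : R :=
  if s is s'.+1 then
    if n is n1.+1 then
      if n1 is n'.+1 then
        qK n1 s + q ^+ (n' - s'.*2) * (1 - q ^+ n'.+1) * qK n' s'
      else 0
    else 0
  else 1.

#[global] Arguments qK : simpl never.

Lemma qKn0 n : qK n 0 = 1. Proof. by case: n. Qed.

Lemma qKSS n s :
  qK n.+2 s.+1 = qK n.+1 s.+1 + q ^+ (n - s.*2) * (1 - q ^+ n.+1) * qK n s.
Proof. by []. Qed.

Lemma qK_small n s : (n < s.*2)%N -> qK n s = 0.
Proof.
elim/ltn_ind: n s => -[|[|n]] IH [|s] // lt_ns.
by rewrite qKSS !IH ?mulr0 ?addr0 //; lia.
Qed.

(** These are the ratios of neighbouring values of the closed form, cross-multiplied because the
    q-factors need not be invertible. They are proved together: the first at n + 1 needs both at n,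
    and the second also needs the first at n + 1. *)
Lemma qK_ratios n :
  (forall s, (1 - q ^+ n.+1) * qK n s = (1 - q ^+ (n.+1 - s.*2)) * qK n.+1 s)
  /\ (forall s, (1 - q ^+ s.+1.*2) * qK n.+1 s.+1
        = (1 - q ^+ (n.+1 - s.*2)) * (1 - q ^+ (n - s.*2)) * qK n.+1 s).
Proof.
elim: n => [|n [IHa IHb]].
  split=> s; first by case: s => [|s] //=; rewrite ?mulr0 // subn0.
  by rewrite (_ : qK 1 s.+1 = 0) // sub0n expr0 subrr !(mulr0, mul0r).
have Ha s : (1 - q ^+ n.+2) * qK n.+1 s = (1 - q ^+ (n.+2 - s.*2)) * qK n.+2 s.
  case: s => [|s]; first by rewrite !qKn0 subn0.
  have -> : (n.+2 - s.+1.*2 = n - s.*2)%N by lia.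
  have [lt_ns|le_sn] := ltnP n s.*2.
    rewrite qKSS (qK_small lt_ns) mulr0 addr0 qK_small ?mulr0 //; lia.
  have IHs := IHb s; have IHs' := IHa s.
  (* This splits 1 - q^(n+2) into (1 - q^(n-2s)) + q^(n-2s) (1 - q^(2s+2)), and the second half is
     what the induction hypothesis evaluates. *)
  have E1 : q ^+ n.+2 = q ^+ (n - s.*2) * q ^+ s.+1.*2.
    by rewrite -exprD; congr (q ^+ _); lia.
  rewrite qKSS E1.
  transitivity ((1 - q ^+ (n - s.*2)) * qK n.+1 s.+1 +
      q ^+ (n - s.*2) * ((1 - q ^+ s.+1.*2) * qK n.+1 s.+1)); first by ring.
  rewrite IHs.
  transitivity ((1 - q ^+ (n - s.*2)) * qK n.+1 s.+1 +
      q ^+ (n - s.*2) * (1 - q ^+ (n - s.*2)) * ((1 - q ^+ n.+1) * qK n s)).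
    by rewrite IHs'; ring.
  by ring.
split=> // s; rewrite qKSS.
have [lt_ns|le_sn] := ltnP n s.*2.
  have E0 : (n.+1 - s.*2 = 0)%N by lia.
  have K0 : qK n.+1 s.+1 = 0 by apply: qK_small; lia.
  by rewrite K0 (qK_small lt_ns) E0 expr0 subrr !(mulr0, addr0, mul0r).
transitivity ((1 - q ^+ s.+1.*2) * qK n.+1 s.+1
   + q ^+ (n - s.*2) * (1 - q ^+ s.+1.*2) * ((1 - q ^+ n.+1) * qK n s)); first by ring.
rewrite IHb IHa.
transitivity ((1 - q ^+ (n.+1 - s.*2)) *
    (1 - q ^+ (n - s.*2) * q ^+ s.+1.*2) * qK n.+1 s); first by ring.
rewrite -exprD (_ : n - s.*2 + s.+1.*2 = n.+2)%N; last lia.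
by rewrite -mulrA Ha; ring.
Qed.

Lemma qK_succ n s :
  (1 - q ^+ n.+1) * qK n s = (1 - q ^+ (n.+1 - s.*2)) * qK n.+1 s.
Proof. by have [] := qK_ratios n. Qed.

Lemma qK_next n s : (1 - q ^+ s.+1.*2) * qK n s.+1
  = (1 - q ^+ (n - s.*2)) * (1 - q ^+ (n.-1 - s.*2)) * qK n s.
Proof.
case: n => [|n]; last by have [] := qK_ratios n.
by rewrite (_ : qK 0 s.+1 = 0) // sub0n expr0 subrr !(mulr0, mul0r).
Qed.

(* sum over i + j + r = s of the q^2-multinomial coefficient (s; i, j, r) times
   A^(i+r) D^(j+r) q^(r^2-r). *)
Fixpoint qT (A D : R) (s : nat) : R :=
  match s with
  | 0 => 1
  | s'.+1 => match s' with
     | 0 => A + D + A * D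
     | s''.+1 => (A + D + A * D * q ^+ s'.*2) * qT A D s'
             - A * D * (1 - q ^+ s'.*2) * qT A D s''
     end
  end.

#[global] Arguments qT : simpl never.

Lemma qT0 A D : qT A D 0 = 1. Proof. by []. Qed.

Lemma qT1 A D : qT A D 1 = A + D + A * D. Proof. by []. Qed.

Lemma qTSS A D s : qT A D s.+2 =
  (A + D + A * D * q ^+ s.+1.*2) * qT A D s.+1 - A * D * (1 - q ^+ s.+1.*2) * qT A D s.
Proof. by []. Qed.

Lemma qTC A D s : qT A D s = qT D A s.
Proof.
suff [] : qT A D s = qT D A s /\ qT A D s.+1 = qT D A s.+1 by [].
elim: s => [|s [IH1 IH2]]; first by split; rewrite ?qT1 ?qT0; ring.
by split=> //; rewrite !qTSS IH1 IH2; ring.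
Qed.

(** The three-term recurrence is traded for a first-order system linking T_s(A,D) and T_s(Aq^2,D).
    Neither identity is inductive alone, so both are carried at once. *)
Lemma qT_shift A D s :
  qT A D s.+1 = A * qT A D s + D * (1 + A) * qT (A * q ^+ 2) D s
  /\ qT (A * q ^+ 2) D s.+1 = q ^+ s.+1.*2 * qT A D s.+1
        + D * (1 - q ^+ s.+1.*2) * qT (A * q ^+ 2) D s.
Proof.
elim: s => [|s [IH1 IH2]]; first by split; rewrite !qT1 !qT0; ring.
have H1 : qT A D s.+2 = A * qT A D s.+1 + D * (1 + A) * qT (A * q ^+ 2) D s.+1.
  rewrite qTSS IH2.
  transitivity (A * qT A D s.+1 + D * (1 + A) * q ^+ s.+1.*2 * qT A D s.+1
      + (1 - q ^+ s.+1.*2) * D * (qT A D s.+1 - A * qT A D s)); first by ring.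
  have -> : qT A D s.+1 - A * qT A D s = D * (1 + A) * qT (A * q ^+ 2) D s.
    by rewrite IH1; ring.
  by ring.
split=> //; rewrite H1 (qTSS (A * q ^+ 2)).
have -> : q ^+ s.+2.*2 = q ^+ 2 * q ^+ s.+1.*2 by rewrite -exprD.
transitivity (D * qT (A * q ^+ 2) D s.+1
    + A * D * q ^+ 2 * q ^+ s.+1.*2 * qT (A * q ^+ 2) D s.+1
    + A * q ^+ 2 * (qT (A * q ^+ 2) D s.+1
                    - D * (1 - q ^+ s.+1.*2) * qT (A * q ^+ 2) D s)).
  by ring.
have -> : qT (A * q ^+ 2) D s.+1 - D * (1 - q ^+ s.+1.*2) * qT (A * q ^+ 2) D s
    = q ^+ s.+1.*2 * qT A D s.+1 by rewrite IH2; ring.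
by ring.
Qed.

(** This stands for the quotient (T_(s+1) - A T_s) / D, written so that [D] need not be
    invertible. *)
Definition qV A D s := (1 + A) * qT (A * q ^+ 2) D s.

Lemma mulD_qV A D s : D * qV A D s = qT A D s.+1 - A * qT A D s.
Proof. by rewrite (qT_shift A D s).1 /qV; ring. Qed.

Lemma qV0 A D : qV A D 0 = 1 + A. Proof. by rewrite /qV mulr1. Qed.

Lemma qVS A D s : qV A D s.+1 =
  (1 + A * q ^+ s.+1.*2) * qT A D s.+1 - A * (1 - q ^+ s.+1.*2) * qT A D s.
Proof.
rewrite /qV (qT_shift A D s).2.
transitivity ((1 + A) * q ^+ s.+1.*2 * qT A D s.+1
    + (1 - q ^+ s.+1.*2) * (D * qV A D s)); first by rewrite /qV; ring.
by rewrite mulD_qV; ring.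
Qed.

End Coefficients.

(** * Closed forms at a finite level and their recurrences *)

Section Finite.
(* B only bounds the summation range: the terms with n + 1 < 2s vanish. *)
Variables (R : comNzRingType) (q c : R) (B : nat).

Local Notation K := (qK q).
Local Notation T := (qT q).

Definition qQ s : R := q ^+ (s * s.-1).
Definition qP m : R := \prod_(j < m) (1 - c * q ^+ j.+1.*2).

Lemma qQS s : qQ s.+1 = qQ s * q ^+ s.*2.
Proof. by rewrite /qQ -exprD; congr (_ ^+ _); case: s => //= s; lia. Qed.

Lemma qPS m : qP m.+1 = qP m * (1 - c * q ^+ m.+1.*2).
Proof. by rewrite /qP big_ord_recr. Qed.

(** With N_k = (q;q)_k (cq;q)_k, the sums [qG], [qH] and [qE] are the closed forms of N_k g_k, N_k
    (1 - c q^(k+1)) FC_k and N_k e_k in the level recursion below. *)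
Definition qG A D n := \sum_(s < B) qQ s * K n.+1 s * T A D s * qP (n - s).
Definition qH A D n := \sum_(s < B) qQ s * K n s * qV q A D s * qP (n - s).
Definition qE A D n := \sum_(s < B) qQ s * K n s * T A D s *
  (qP (n - s) + A * qP (n - s.+1) * q ^+ n.-1 * (1 - q ^+ (n - s.*2))).

(** Summation by parts: [qVS] writes V_s through T_s and T_(s-1), and shifting the index of the
    latter leaves a single sum over T_s. *)
Lemma qH_expand A D n : (n < B)%N -> qH A D n =
  \sum_(s < B) qQ s * K n s * T A D s * ((1 + A * q ^+ s.*2) * qP (n - s)
    - A * q ^+ s.*2 * (1 - q ^+ (n - s.*2)) * (1 - q ^+ (n.-1 - s.*2))
      * qP (n - s.+1)).
Proof.
rewrite /qH; case: B => // b lt_nb.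
transitivity (\sum_(s < b.+1) qQ s * K n s * T A D s * (1 + A * q ^+ s.*2) * qP (n - s)
  - \sum_(s < b) qQ s.+1 * ((1 - q ^+ s.+1.*2) * K n s.+1) * T A D s * A * qP (n - s.+1)).
  rewrite 2!big_ord_recl /= qV0 -addrA -sumrB; congr (_ + _).
    by rewrite double0 expr0 qT0; ring.
  by apply: eq_bigr => s _; rewrite /bump /= !add1n qVS; ring.
(* The extra term s = b vanishes because n < b + 1, so both sums run over the same range. *)
have -> : \sum_(s < b) qQ s.+1 * ((1 - q ^+ s.+1.*2) * K n s.+1) * T A D s * A * qP (n - s.+1)
   = \sum_(s < b.+1) qQ s.+1 * ((1 - q ^+ s.+1.*2) * K n s.+1) * T A D s * A * qP (n - s.+1).
  by rewrite big_ord_recr /= (@qK_small _ _ n b.+1) ?(mulr0, mul0r) ?addr0 //; lia.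
rewrite -sumrB; apply: eq_bigr => s _.
by rewrite qQS qK_next; ring.
Qed.

Lemma qH_step A D n : (n.+1 < B)%N ->
  qH A D n.+1 = qE A D n.+1 + A * q ^+ n.+1 * (1 - c * q ^+ n.+1) * qG A D n.
Proof.
move=> lt_nB; rewrite qH_expand // /qE /qG mulr_sumr -big_split /=.
apply: eq_bigr => s _.
have [lt_ns|le_sn] := ltnP n.+1 s.*2; first by rewrite (qK_small _ lt_ns); ring.
have [t Et] : exists t, n.+1 = (s.*2 + t)%N by exists (n.+1 - s.*2)%N; lia.
(* The case n + 1 = 2s stands apart: there n - 2s truncates, but next to a factor 1 - q^0 = 0. *)
case: t => [|t] in Et *.
  have -> : (n.+1 - s.*2 = 0)%N by lia.
  case: s => [[|s] lts] /= in Et le_sn *; first by lia.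
  have -> : (n.+1 - s.+1 = (n - s.+1).+1)%N by lia.
  rewrite qPS; have -> : (n - s.+1).+1.*2 = n.+1 by lia.
  have -> : s.+1.*2 = n.+1 by lia.
  by rewrite expr0; ring.
have -> : (n.+1 - s.*2 = t.+1)%N by lia.
have -> : (n - s.*2 = t)%N by lia.
have -> : (n.+1 - s = (s + t).+1)%N by lia.
have -> : (n.+1 - s.+1 = s + t)%N by lia.
have -> : (n - s = s + t)%N by lia.
have -> : n = (s + s + t)%N by lia.
by rewrite qPS -!addnn -!addSn !(exprD, exprS); ring.
Qed.

Lemma qE_step A D n : (n < B)%N ->
  qE A D n.+1 = (1 - c * q ^+ n.+1) * qG A D n
    + (1 - q ^+ n.+1) * (qH A D n - (1 - c * q ^+ n.+1) * qE A D n).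
Proof.
move=> lt_nB; rewrite qH_expand // /qE /qG !mulr_sumr -sumrB mulr_sumr -big_split /=.
apply: eq_bigr => s _.
set X := (Y in qQ s * K n s * T A D s * Y - _).
set Y := (Y in _ * (qQ s * K n s * T A D s * Y)).
transitivity ((1 - c * q ^+ n.+1) * (qQ s * K n.+1 s * T A D s * qP (n - s))
   + qQ s * ((1 - q ^+ n.+1) * K n s) * T A D s * (X - (1 - c * q ^+ n.+1) * Y));
  last by ring.
rewrite qK_succ {}/X {}/Y.
have [lt_ns|le_sn] := ltnP n.+1 s.*2; first by rewrite (qK_small _ lt_ns); ring.
have [t Et] : exists t, n.+1 = (s.*2 + t)%N by exists (n.+1 - s.*2)%N; lia.
case: t => [|t] in Et *.
  have -> : (n.+1 - s.*2 = 0)%N by lia.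
  case: s => [[|s] lts] /= in Et le_sn *; first by lia.
  have -> : (n.+1 - s.+1 = (n - s.+1).+1)%N by lia.
  rewrite qPS; have -> : (n - s.+1).+1.*2 = n.+1 by lia.
  by rewrite expr0; ring.
have -> : (n.+1 - s.*2 = t.+1)%N by lia.
have -> : (n - s.*2 = t)%N by lia.
have -> : (n.+1 - s = (s + t).+1)%N by lia.
have -> : (n.+1 - s.+1 = s + t)%N by lia.
have -> : (n - s = s + t)%N by lia.
(* Likewise, for n = 2s the truncated n - 1 - 2s sits next to a vanishing factor. *)
case: t => [|t] in Et *.
  have -> : (n.-1 - s.*2 = 0)%N by lia.
  have -> : n = (s + s)%N by lia.
  by rewrite qPS addn0 -!addnn !(exprD, exprS, expr0); ring.
have -> : (n.-1 - s.*2 = t)%N by lia.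
have -> : (n - s.+1 = s + t)%N by lia.
have -> : n = (s + s + t).+1 by lia.
by rewrite addnS !qPS -!addnn -!addSn /= !(exprD, exprS); ring.
Qed.

(** Unlike the two other steps this is not termwise: D V_s = T_(s+1) - A T_s raises the index, and
    the Pascal-type rule [qKSS] recombines the shifted sum. *)
Lemma qG_step A D n : (n.+1 < B)%N ->
  qG A D n.+1 = qE A D n.+1 + (1 - q ^+ n.+1) * D * q ^+ n * qH A D n.
Proof.
move=> lt_nB.
have -> : (1 - q ^+ n.+1) * D * q ^+ n * qH A D n =
  \sum_(s < B) qQ s * q ^+ n * ((1 - q ^+ n.+1) * K n s) * T A D s.+1 * qP (n - s)
  - \sum_(s < B) qQ s * q ^+ n * ((1 - q ^+ n.+1) * K n s) * A * T A D s * qP (n - s).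
  rewrite mulr_sumr -sumrB; apply: eq_bigr => s _.
  transitivity ((1 - q ^+ n.+1) * q ^+ n * qQ s * K n s * (D * qV q A D s) * qP (n - s)).
    by ring.
  by rewrite mulD_qV; ring.
rewrite addrCA -sumrB.
have -> : \sum_(i < B) (qQ i * K n.+1 i * T A D i *
    (qP (n.+1 - i) + A * qP (n.+1 - i.+1) * q ^+ n.+1.-1 * (1 - q ^+ (n.+1 - i.*2))) -
    qQ i * q ^+ n * ((1 - q ^+ n.+1) * K n i) * A * T A D i * qP (n - i))
  = \sum_(s < B) qQ s * K n.+1 s * T A D s * qP (n.+1 - s).
  by apply: eq_bigr => s _; rewrite qK_succ subSS /=; ring.
rewrite /qG; case: B lt_nB => // b lt_nb.
rewrite big_ord_recl [in RHS]big_ord_recr /= (@qK_small _ _ n b) ?mulr0 ?mul0r ?addr0; last by lia.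
rewrite [X in _ = _ + X]big_ord_recl /= !qKn0 addrCA; congr (_ + _).
rewrite -big_split /=; apply: eq_bigr => s _; rewrite /bump /= add1n subSS qKSS.
have [lt_ns|le_sn] := ltnP n s.*2; first by rewrite (qK_small _ lt_ns); ring.
have -> : q ^+ n = q ^+ s.*2 * q ^+ (n - s.*2) by rewrite -exprD; congr (_ ^+ _); lia.
by rewrite qQS; ring.
Qed.

End Finite.

(** * Levels beyond the truncation order: the product formula *)

Section Limit.
Variables (R : comNzRingType) (q c : R) (B : nat).
Local Notation G := (qG q c B).
Local Notation H := (qH q c B).
Local Notation E := (qE q c B).
Local Notation P := (qP q c).

Lemma qG_base A D : (0 < B)%N -> G A D 0 = 1.
Proof.
rewrite /qG; case: B => // b _; rewrite big_ord_recl big1 => [|s _].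
  by rewrite qKn0 qT0 /qQ /qP big_ord0 expr0; ring.
by rewrite (@qK_small _ _ 1%N) ?mulr0 ?mul0r // /bump /=; lia.
Qed.

Lemma qE_base A D : (0 < B)%N -> E A D 0 = 1.
Proof.
rewrite /qE; case: B => // b _; rewrite big_ord_recl big1 => [|s _].
  by rewrite qKn0 qT0 /qQ /qP big_ord0 expr0; ring.
by rewrite (@qK_small _ _ 0%N) ?mulr0 ?mul0r // /bump /=; lia.
Qed.

Lemma qH_base A D : (0 < B)%N -> H A D 0 = 1 + A.
Proof.
rewrite /qH; case: B => // b _; rewrite big_ord_recl big1 => [|s _].
  by rewrite qKn0 qV0 /qQ /qP big_ord0 expr0; ring.
by rewrite (@qK_small _ _ 0%N) ?mulr0 ?mul0r // /bump /=; lia.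
Qed.

Variable m : nat.
Hypothesis qm0 : q ^+ m = 0.
Hypothesis lt_mB : (m.+1 < B)%N.

(** The increment of K carries q^(m-2s), and passing from Q_s to Q_(s+1) supplies q^(2s); together
    they give q^m = 0. *)
Lemma qQK_stable s : qQ q s * qK q m.+2 s = qQ q s * qK q m.+1 s.
Proof.
case: s => [|s]; first by rewrite !qKn0.
rewrite qKSS mulrDr; have [lt_ms|le_sm] := ltnP m s.*2.
  by rewrite (qK_small _ lt_ms) !mulr0 addr0.
rewrite [X in _ + X](_ : _ = qQ q s * (q ^+ s.*2 * q ^+ (m - s.*2)) *
    (1 - q ^+ m.+1) * qK q m s); last by rewrite qQS; ring.
by rewrite -exprD subnKC // qm0 mulr0 !mul0r addr0.
Qed.

(** Once q^m = 0 the recurrences collapse to G = E = H at level m + 1, and H is (1 + A) times a sum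
    with T_s(Aq^2,D). *)
Lemma qG_shift A D : G A D m.+1 = (1 + A) * G (A * q ^+ 2) D m.+1.
Proof.
transitivity (H A D m.+1).
  by rewrite qG_step // qH_step // exprS qm0 !(mulr0, mul0r).
rewrite /qH /qG mulr_sumr; apply: eq_bigr => s _.
by rewrite qQK_stable /qV; ring.
Qed.

Lemma qG_iter A D j : G A D m.+1 =
  \prod_(i < j) (1 + A * q ^+ i.*2) * G (A * q ^+ j.*2) D m.+1.
Proof.
elim: j => [|j ->]; first by rewrite big_ord0 expr0 mulr1 mul1r.
have -> : A * q ^+ j.+1.*2 = A * q ^+ j.*2 * q ^+ 2.
  by rewrite doubleS -addn2 exprD mulrA.
by rewrite big_ord_recr /= (qG_shift (A * q ^+ j.*2)) mulrA.
Qed.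

Lemma qGC A D n : G A D n = G D A n.
Proof. by apply: eq_bigr => s _; rewrite qTC. Qed.

Lemma qG00 n : G 0 0 n = P n.
Proof.
have T0 s : qT q (0 : R) 0 s.+1 = 0.
  by rewrite (qT_shift q 0 0 s).1; ring.
rewrite /qG; case: B lt_mB => // b _; rewrite big_ord_recl big1 => [|s _].
  by rewrite qKn0 qT0 /qQ expr0 subn0; ring.
by rewrite T0 mulr0 mul0r.
Qed.

Lemma qG_product A D N : A * q ^+ N.*2 = 0 -> D * q ^+ N.*2 = 0 ->
  G A D m.+1 = \prod_(i < N) (1 + A * q ^+ i.*2) * \prod_(i < N) (1 + D * q ^+ i.*2)
             * P m.+1.
Proof.
move=> A0 D0; rewrite (qG_iter A D N) A0 qGC (qG_iter D 0 N) D0 qG00.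
by rewrite mulrA.
Qed.

End Limit.

(** * Solving the level recursion *)

Section LevelRecursion.
Variables (R : comNzRingType) (q c A D : R) (B : nat).
(* FA, FB, FC: tails allowed after a part of colour a, b, and c or d (the last two
   agree); g: all sequences on the levels below k; e: those without d at level k-1. *)
Variables (FA FB FC g e : nat -> R).
Hypothesis g0 : g 0 = 1.
Hypothesis e0 : e 0 = 1.
Hypothesis FA0 : FA 0 = 1.
Hypothesis FAS : forall k, FA k.+1 = FB k.
Hypothesis FBE : forall k, FB k = g k + q ^+ k.+1 * FB k.
Hypothesis FCE : forall k, FC k = e k + A * q ^+ k * FA k + c * q ^+ k.+1 * FC k.
Hypothesis eS : forall k, e k.+1 = FB k + FC k - e k.
Hypothesis gS : forall k, g k.+1 = e k.+1 + D * q ^+ k * FC k.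

(** Repeating b or c within a level produces the denominators 1 - q^(k+1) and 1 - c q^(k+1).
    Multiplying by N_k clears them and leaves exactly the recurrences of [qG], [qE] and [qH]. *)
Lemma level_recursion k : (k < B)%N ->
  (\prod_(j < k) (1 - q ^+ j.+1)) * (\prod_(j < k) (1 - c * q ^+ j.+1)) * g k
   = qG q c B A D k.
Proof.
move=> lt_kB; pose N k := (\prod_(j < k) (1 - q ^+ j.+1)) * (\prod_(j < k) (1 - c * q ^+ j.+1)).
have NS j : N j.+1 = N j * (1 - q ^+ j.+1) * (1 - c * q ^+ j.+1).
  by rewrite /N !big_ord_recr /=; ring.
have FB' j : (1 - q ^+ j.+1) * FB j = g j by rewrite mulrBl mul1r {1}FBE addrK.
have FC' j : (1 - c * q ^+ j.+1) * FC j = e j + A * q ^+ j * FA j.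
  by rewrite mulrBl mul1r {1}FCE addrK.
suff [] : [/\ N k * g k = qG q c B A D k, N k * e k = qE q c B A D k &
   N k * ((1 - c * q ^+ k.+1) * FC k) = qH q c B A D k] by [].
elim: k lt_kB => [|k IHk] lt_kB.
  rewrite qG_base // qE_base // qH_base // /N !big_ord0 FC' g0 e0 FA0 expr0.
  by split; ring.
have [IHg IHe IHh] := IHk (ltnW lt_kB).
have He : N k.+1 * e k.+1 = qE q c B A D k.+1.
  rewrite qE_step -?IHg -?IHe -?IHh -?FB'; last exact: ltnW.
  by rewrite NS eS; ring.
split=> //.
  by rewrite qG_step // -He -IHh gS NS; ring.
rewrite FC' mulrDr He FAS qH_step //; congr (_ + _).
by rewrite -IHg -FB' NS; ring.
Qed.

End LevelRecursion.

(** * Sums over bounded sequences, over colours, and of multiples *)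

Section BigBseq.
Variables (R : nmodType) (T : finType).

Lemma sum_bseq0 (f : seq T -> R) : \sum_(s : 0.-bseq T) f s = f [::].
Proof.
rewrite (big_pred1 [bseq]) // => s; apply/esym/eqP/val_inj => /=.
by case: s => [[]].
Qed.

Lemma sum_bseqS L (f : seq T -> R) : \sum_(s : L.+1.-bseq T) f s
  = f [::] + \sum_(y : T) \sum_(s : L.-bseq T) f (y :: s).
Proof.
rewrite (bigD1 [bseq]) //=; congr (_ + _).
rewrite pair_bigA /=.
(* Prepending an element is inverted by [h'], partial because of the empty sequence; the default of
   [insub_bseq] is never reached, the tail having length at most L. *)
pose h (p : T * L.-bseq T) : L.+1.-bseq T := [bseq of p.1 :: p.2].
pose h' (s : L.+1.-bseq T) : option (T * L.-bseq T) :=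
  if val s is y :: s' then Some (y, insub_bseq L s') else None.
rewrite (reindex_omap h h') => [|[[|y s] ls] //= _].
  apply: eq_bigl => -[y s] /=.
  rewrite /h' /= /insub_bseq; apply/eqP; congr Some; congr pair.
  by apply: val_inj; rewrite insubdK // -topredE /= size_bseq.
congr Some; apply: val_inj; rewrite /= /insub_bseq insubdK //.
Qed.

End BigBseq.

(* [==] on [colour] goes through [inord] and does not compute. *)
Lemma eq_colourE (x y : colour) : (x == y) =
  match x, y with Ca, Ca | Cb, Cb | Cc, Cc | Cd, Cd => true | _, _ => false end.
Proof. by apply/eqP/idP; case: x; case: y. Qed.

Lemma sum_colour (R : nmodType) (f : colour -> R) :
  \sum_x f x = f Ca + f Cb + f Cc + f Cd.
Proof.
rewrite (bigD1 Ca) // (bigD1 Cb) ?eq_colourE // (bigD1 Cc) ?eq_colourE //.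
rewrite (bigD1 Cd) ?eq_colourE //= big1 ?addr0 ?addrA //.
by case; rewrite !eq_colourE.
Qed.

Lemma sum_multiple (R : comNzRingType) (I : finType) (y : R) (f : I -> R) :
  (forall i, exists r, f i = y * r) -> exists r, \sum_i f i = y * r.
Proof.
move=> fP; apply: (big_ind (fun z => exists r, z = y * r)) => // [|u v].
  by exists 0; rewrite mulr0.
by move=> [r ->] [t ->]; exists (r + t); rewrite mulrDr.
Qed.

(** * Weighted sums over admissible sequences, sorted by level *)

Section WeightedSequences.
Variables (R : comNzRingType) (x a c d : R) (n : nat).
Hypothesis xn0 : x ^+ n.+1 = 0.

Definition colour_weight (y : colour) : R :=
  match y with Ca => a | Cb => 1 | Cc => c | Cd => d end.
Definition weight (p : cpart) : R := colour_weight p.2 * x ^+ p.1.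

Definition to_cpart (y : 'I_n.+1 * colour) : cpart := (val y.1, y.2).

Definition tail_weight (p : cpart) (s : seq cpart) : R :=
  if all part_ok s && path diff_ok p s then \prod_(y <- s) weight y else 0.

Definition tails L p := \sum_(s : L.-bseq ('I_n.+1 * colour)%type)
  tail_weight p (map to_cpart s).

Lemma tails0 p : tails 0 p = 1.
Proof.
rewrite /tails (sum_bseq0 (fun s => tail_weight p (map to_cpart s))).
by rewrite /tail_weight /= big_nil.
Qed.

Lemma tailsS L p : tails L.+1 p = 1 + \sum_(y : 'I_n.+1 * colour)
  if part_ok (to_cpart y) && diff_ok p (to_cpart y)
  then weight (to_cpart y) * tails L (to_cpart y) else 0.
Proof.
rewrite /tails (sum_bseqS _ (fun s => tail_weight p (map to_cpart s))).
congr (_ + _); first by rewrite /tail_weight /= big_nil.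
apply: eq_bigr => y _; case: ifP => [/andP[y_ok py_ok]|y_nok].
  rewrite mulr_sumr; apply: eq_bigr => s _.
  rewrite /tail_weight /= y_ok py_ok /= big_cons.
  by case: ifP => _ //; rewrite mulr0.
apply: big1 => s _; rewrite /tail_weight /=.
by move: y_nok; case: (part_ok _) => //= ->; rewrite andbF.
Qed.

(** Raising the length bound adds only sequences of L + 1 positive parts, whose weights contain
    x^(L+1). *)
Lemma tails_increment L p : exists r, tails L.+1 p = tails L p + x ^+ L.+1 * r.
Proof.
elim: L p => [|L IHL] p.
  rewrite tailsS tails0.
  suff [r ->] : exists r, \sum_(y : 'I_n.+1 * colour)
     (if part_ok (to_cpart y) && diff_ok p (to_cpart y)
      then weight (to_cpart y) * tails 0 (to_cpart y) else 0) = x ^+ 1 * r by exists r.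
  apply: sum_multiple => y.
  case: ifP => [/andP[/and3P[/= y_gt0 _ _] _]|_]; last by exists 0; rewrite mulr0.
  exists (colour_weight y.2 * x ^+ (y.1).-1 * tails 0 (to_cpart y)).
  by rewrite /weight /= -{1}(prednK y_gt0) exprS expr1; ring.
rewrite (tailsS L.+1) (tailsS L).
set S := \sum_y _; set S' := \sum_y _.
suff [r ->] : exists r, S = S' + x ^+ L.+2 * r by exists r; rewrite addrA.
suff [r Er] : exists r, S - S' = x ^+ L.+2 * r by exists r; rewrite -Er addrC subrK.
rewrite /S /S' -sumrB; apply: sum_multiple => y.
case: ifP => [/andP[/and3P[/= y_gt0 _ _] _]|_]; last by exists 0; rewrite mulr0 subrr.
have [r ->] := IHL (to_cpart y).
exists (colour_weight y.2 * x ^+ (y.1).-1 * r).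
by rewrite /weight /= -{1 2}(prednK y_gt0) !exprS; ring.
Qed.

(* n parts suffice, since longer sequences have weight divisible by x^(n+1). *)
Definition tail p := tails n p.

Lemma tailE p : tail p = 1 + \sum_(y : 'I_n.+1 * colour)
  if part_ok (to_cpart y) && diff_ok p (to_cpart y)
  then weight (to_cpart y) * tail (to_cpart y) else 0.
Proof.
rewrite -tailsS; have [r ->] := tails_increment n p.
by rewrite xn0 mul0r addr0.
Qed.

Lemma weight_large p : (n < p.1)%N -> weight p = 0.
Proof. by move=> lt_np; rewrite /weight -(subnKC lt_np) exprD xn0 mul0r mulr0. Qed.

Definition partA j : cpart := (j.*2.+1, Ca).
Definition partB j : cpart := (j.*2.+2, Cb).
Definition partC j : cpart := (j.*2.+2, Cc).
Definition partD j : cpart := (j.*2.+3, Cd).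

(** Sizes up to 2m + 1 fill the levels below m and reach only (2m+1)_a of level m: a part (2m+1)_d
    belongs to level m - 1, or is the forbidden 1_d when m = 0. *)
Lemma sum_levels (h : cpart -> R) m : (forall p, ~~ part_ok p -> h p = 0) ->
  \sum_(j < m.*2.+2) \sum_y h (val j, y) =
  \sum_(j < m) (h (partA j) + h (partB j) + h (partC j) + h (partD j)) + h (partA m).
Proof.
move=> h0; elim: m => [|m IHm].
  rewrite !big_ord_recr !big_ord0 /= !sum_colour !add0r /partA /=.
  have [b1 c1 d1] : [/\ h (1%N, Cb) = 0, h (1%N, Cc) = 0 & h (1%N, Cd) = 0].
    by split; apply: h0; rewrite /part_ok /= ?eqxx ?eq_colourE.
  by rewrite !(h0 (0%N, _)) // b1 c1 d1 !(add0r, addr0).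
rewrite doubleS 2!big_ord_recr /= {}IHm !sum_colour /= [in RHS]big_ord_recr /=.
rewrite /partA /partB /partC /partD doubleS.
have [a2 d2] : h (m.*2.+2, Ca) = 0 /\ h (m.*2.+2, Cd) = 0.
  by split; apply: h0; rewrite /part_ok /= odd_double !eq_colourE.
have [b3 c3] : h (m.*2.+3, Cb) = 0 /\ h (m.*2.+3, Cc) = 0.
  by split; apply: h0; rewrite /part_ok /= odd_double !eq_colourE.
rewrite a2 d2 b3 c3; ring.
Qed.

Definition restrict p y := if diff_ok p y then weight y * tail y else 0.

Lemma tail_levels p m : (n <= m)%N -> tail p = 1
  + \sum_(j < m) restrict p (partA j) + \sum_(j < m) restrict p (partB j)
  + \sum_(j < m) restrict p (partC j) + \sum_(j < m) restrict p (partD j).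
Proof.
move=> le_nm; rewrite tailE -!addrA; congr (_ + _); rewrite -!big_split /=.
pose h y := if part_ok y && diff_ok p y then weight y * tail y else 0.
have hr y : part_ok y -> h y = restrict p y by rewrite /h /restrict => ->.
transitivity (\sum_(j < m.*2.+2) \sum_y h (val j, y)).
  have le_nm2 : (n.+1 <= m.*2.+2)%N by lia.
  rewrite -(pair_bigA _ (fun (i : 'I_n.+1) y => h (val i, y))) /=.
  rewrite (big_ord_widen _ (fun j => \sum_y h (j, y)) le_nm2) big_mkcond /=.
  apply: eq_bigr => j _; case: ltnP => // lt_nj.
  rewrite big1 // => y _; rewrite /h weight_large // mul0r.
  by case: ifP.
rewrite sum_levels => [|y /negPf y_nok]; last by rewrite /h y_nok.
have -> : h (partA m) = 0.
  by rewrite /h weight_large ?mul0r ?if_same //=; lia.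
rewrite addr0.
apply: eq_bigr => j _; by rewrite !hr ?addrA //;
  rewrite /part_ok /= odd_double ?xpair_eqE !eq_colourE ?andbF.
Qed.

End WeightedSequences.

(** * Truncated sums and products, geometric inverses *)

Lemma sum_ord_if (R : nmodType) (f : nat -> R) (b : pred nat) k m :
  (k <= m)%N -> (forall j, b j = (j < k)%N) ->
  \sum_(j < m) (if b j then f j else 0) = \sum_(j < k) f j.
Proof.
move=> le_km bE; rewrite -big_mkcond (big_ord_widen _ f le_km).
by apply: eq_bigl => j; rewrite bE.
Qed.

Lemma prod_ord_stable (R : comNzRingType) (f : nat -> R) k m :
  (k <= m)%N -> (forall j, (k <= j)%N -> f j = 1) ->
  \prod_(j < m) f j = \prod_(j < k) f j.
Proof.
move=> le_km f1; rewrite (big_ord_widen _ f le_km) [RHS]big_mkcond /=.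
by apply: eq_bigr => j _; case: ltnP => // /f1.
Qed.

Lemma prod_ord_double (R : comNzRingType) (f : nat -> R) m :
  \prod_(j < m.*2) f j = \prod_(j < m) f j.*2 * \prod_(j < m) f j.*2.+1.
Proof.
elim: m => [|m IHm]; first by rewrite !big_ord0 mulr1.
by rewrite doubleS !big_ord_recr /= IHm; ring.
Qed.

Lemma geometric_inverse (R : comNzRingType) (y : R) N :
  y ^+ N.+1 = 0 -> (1 - y) * \sum_(i < N.+1) y ^+ i = 1.
Proof. by move=> y0; rewrite -opprB mulNr -subrX1 y0 sub0r opprK. Qed.

Lemma prod_geometric_inverse (R : comNzRingType) (y : nat -> R) N m :
  (forall j, y j ^+ N.+1 = 0) ->
  \prod_(j < m) (1 - y j) * \prod_(j < m) \sum_(i < N.+1) y j ^+ i = 1.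
Proof.
by move=> y0; rewrite -big_split big1 //= => j _; rewrite geometric_inverse.
Qed.

(** * From the difference conditions to the truncated product *)

Section Levels.
Variables (R : comNzRingType) (x a c d : R) (n : nat).
Hypothesis xn0 : x ^+ n.+1 = 0.

Local Notation q := (x ^+ 2).
Local Notation tail := (tail x a c d n).
Local Notation weight := (weight x a c d).

Definition psum (part : nat -> cpart) k := \sum_(j < k) weight (part j) * tail (part j).
Local Notation SA := (psum partA).
Local Notation SB := (psum partB).
Local Notation SC := (psum partC).
Local Notation SD := (psum partD).

Lemma psumS part k : psum part k.+1 = psum part k + weight (part k) * tail (part k).
Proof. by rewrite /psum big_ord_recr. Qed.

(** For each colour the parts allowed next form an initial run of levels, so four thresholds
    determine a tail. *)
Lemma tail_psum p ka kb kc kd :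
  (forall j, diff_ok p (partA j) = (j < ka)%N) ->
  (forall j, diff_ok p (partB j) = (j < kb)%N) ->
  (forall j, diff_ok p (partC j) = (j < kc)%N) ->
  (forall j, diff_ok p (partD j) = (j < kd)%N) ->
  tail p = 1 + SA ka + SB kb + SC kc + SD kd.
Proof.
move=> pa pb pc pd.
pose m := (n + ka + kb + kc + kd)%N.
have E part k : (k <= m)%N -> (forall j, diff_ok p (part j) = (j < k)%N) ->
    \sum_(j < m) restrict x a c d n p (part j) = psum part k.
  exact: (@sum_ord_if _ (fun j => weight (part j) * tail (part j))).
rewrite (@tail_levels _ x a c d n xn0 p m); last by rewrite /m; lia.
by rewrite (E _ _ _ pa) ?(E _ _ _ pb) ?(E _ _ _ pc) ?(E _ _ _ pd) // /m; lia.
Qed.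

Lemma tailA k : tail (partA k) = 1 + SA k.-1 + SB k + SC k.-1 + SD k.-1.
Proof. by apply: tail_psum => j; rewrite /diff_ok /=; lia. Qed.

Lemma tailB k : tail (partB k) = 1 + SA k + SB k.+1 + SC k + SD k.
Proof. by apply: tail_psum => j; rewrite /diff_ok /=; lia. Qed.

Lemma tailC k : tail (partC k) = 1 + SA k.+1 + SB k + SC k.+1 + SD k.-1.
Proof. by apply: tail_psum => j; rewrite /diff_ok /=; lia. Qed.

(** The thresholds agree with those of [tailC], which is why one sequence [FC] serves both
    colours. *)
Lemma tailD k : tail (partD k) = 1 + SA k.+1 + SB k + SC k.+1 + SD k.-1.
Proof. by apply: tail_psum => j; rewrite /diff_ok /=; lia. Qed.

Lemma psum0 part : psum part 0 = 0. Proof. by rewrite /psum big_ord0. Qed.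

Lemma weightA k : weight (partA k) = a * x * q ^+ k.
Proof. by rewrite /weight /= exprS -exprM mul2n mulrA. Qed.
Lemma weightB k : weight (partB k) = q ^+ k.+1.
Proof. by rewrite /weight /= -exprM mul2n mul1r. Qed.
Lemma weightC k : weight (partC k) = c * q ^+ k.+1.
Proof. by rewrite /weight /= -exprM mul2n. Qed.
Lemma weightD k : weight (partD k) = d * x ^+ 3 * q ^+ k.
Proof. by rewrite /weight /= -exprM mul2n -mulrA -exprD. Qed.

Lemma level_product k B : (k < B)%N ->
  \prod_(j < k) (1 - q ^+ j.+1) * \prod_(j < k) (1 - c * q ^+ j.+1)
    * (1 + SA k + SB k + SC k + SD k)
  = qG q c B (a * x) (d * x ^+ 3) k.
Proof.
apply: (@level_recursion _ q c (a * x) (d * x ^+ 3) B (fun k => tail (partA k))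
  (fun k => tail (partB k)) (fun k => tail (partC k))
  (fun k => 1 + SA k + SB k + SC k + SD k)
  (fun k => 1 + SA k + SB k + SC k + SD k.-1)).
- by rewrite !psum0 !addr0.
- by rewrite !psum0 !addr0.
- by rewrite tailA !psum0 !addr0.
- by move=> j; rewrite tailA tailB.
- by move=> j; rewrite -weightB {1}tailB psumS; ring.
- by move=> j; rewrite -weightA -weightC {1}tailC !psumS; ring.
(* Inclusion-exclusion: the first parts allowed after b and after c at level j together cover those
   counted by e_(j+1), and their overlap is counted by e_j. *)
- by move=> j; rewrite tailB tailC /=; ring.
- by move=> j; rewrite -weightD tailC -(tailD j) (psumS partD) /=; ring.
Qed.

(** The entries of row a of B_2 are at most 4, so (n+4)_a may precede every part of size at most n;
    larger parts weigh nothing. *)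
Lemma tail_top m : (n <= m)%N ->
  tail (n + 4, Ca)%N = 1 + SA m + SB m + SC m + SD m.
Proof.
move=> le_nm; rewrite (tail_levels _ _ _ xn0 _ le_nm) /psum.
have E part : \sum_(j < m) restrict x a c d n (n + 4, Ca)%N (part j)
   = \sum_(j < m) weight (part j) * tail (part j).
  apply: eq_bigr => j _; rewrite /restrict /diff_ok /=.
  have [le_pn|lt_np] := leqP (part j).1 n; last by rewrite (weight_large _ _ _ xn0 lt_np) mul0r if_same.
  by rewrite ifT //; case: (part j).2; rewrite /= leq_add.
by rewrite !E.
Qed.

Lemma tail_product N : (n <= N)%N -> tail (n + 4, Ca)%N =
  \prod_(j < N) (1 + a * x ^+ (4 * j + 1))
  * \prod_(j < N) (1 + d * x ^+ (4 * j + 3))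
  * (\prod_(j < N) \sum_(i < N.+1) x ^+ (2 * j.+1 * i))
  * (\prod_(j < N) \sum_(i < N.+1) c ^+ i * x ^+ ((4 * j + 2) * i)).
Proof.
move=> le_nN.
have x0 k : (n < k)%N -> x ^+ k = 0.
  by move=> lt_nk; rewrite -(subnKC lt_nk) exprD xn0 mul0r.
have q0 k : (n < k.*2)%N -> q ^+ k = 0 by move=> lt_nk; rewrite -exprM mul2n x0.
(* Large enough for q^m = 0, and with m + 1 even, so that the product over c splits by parity. *)
pose m := N.*2.+1.
rewrite (@tail_top m.+1); last by rewrite /m; lia.
set g := 1 + _ + _ + _ + _.
have := @level_product m.+1 m.+3 (leqnSn _).
rewrite -/g (@qG_product _ _ _ _ m _ _ _ _ N); first last.
- by rewrite -mulrA -exprM -exprD x0 ?mulr0 //; lia.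
- by rewrite -mulrA -exprM -exprS x0 ?mulr0 //; lia.
- by [].
- by rewrite q0 // /m; lia.
set PA := \prod_(i < N) _; set PD := \prod_(i < N) _.
have -> : \prod_(j < N) (1 + a * x ^+ (4 * j + 1)) = PA.
  apply: eq_bigr => j _; rewrite -exprM -mulrA -exprS.
  by congr (1 + a * x ^+ _); lia.
have -> : \prod_(j < N) (1 + d * x ^+ (4 * j + 3)) = PD.
  apply: eq_bigr => j _; rewrite -exprM -mulrA -exprD.
  by congr (1 + d * x ^+ _); lia.
rewrite (@prod_ord_stable _ (fun j => 1 - q ^+ j.+1) N); first last.
- by move=> j le_Nj; rewrite q0 ?subr0 //; lia.
- by rewrite /m; lia.
have -> : m.+1 = N.+1.*2 by rewrite /m; lia.
(* The odd powers of q give (c x^2; x^4); the even ones will cancel against [qP]. *)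
rewrite (prod_ord_double (fun j => 1 - c * q ^+ j.+1)).
rewrite (@prod_ord_stable _ (fun j => 1 - c * q ^+ j.*2.+1) N); first last.
- by move=> j le_Nj; rewrite q0 ?mulr0 ?subr0 //; lia.
- by [].
rewrite /qP (@prod_ord_stable _ (fun j => 1 - c * q ^+ j.+1.*2) N N.+1.*2); first last.
- by move=> j le_Nj; rewrite q0 ?mulr0 ?subr0 //; lia.
- by lia.
rewrite (@prod_ord_stable _ (fun j => 1 - c * q ^+ j.*2.+2) N N.+1); first last.
- by move=> j le_Nj; rewrite q0 ?mulr0 ?subr0 //; lia.
- by [].
(* Nilpotency makes the geometric sums cut at N exact inverses. *)
have nil k y : (y * q ^+ k.+1) ^+ N.+1 = 0.
  by rewrite exprMn -!exprM x0 ?mulr0 //; nia.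
have nil1 k : (q ^+ k.+1) ^+ N.+1 = 0 by rewrite -[q ^+ _]mul1r nil.
have IB := @prod_geometric_inverse _ (fun j => q ^+ j.+1) N N nil1.
have IC := @prod_geometric_inverse _ (fun j => c * q ^+ j.*2.+1) N N (fun j => nil _ c).
have IC' := @prod_geometric_inverse _ (fun j => c * q ^+ j.*2.+1.+1) N N (fun j => nil _ c).
have -> : \prod_(j < N) \sum_(i < N.+1) x ^+ (2 * j.+1 * i)
   = \prod_(j < N) \sum_(i < N.+1) (q ^+ j.+1) ^+ i.
  by apply: eq_bigr => j _; apply: eq_bigr => i _; rewrite -!exprM mulnA.
have -> : \prod_(j < N) \sum_(i < N.+1) c ^+ i * x ^+ ((4 * j + 2) * i)
   = \prod_(j < N) \sum_(i < N.+1) (c * q ^+ j.*2.+1) ^+ i.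
  apply: eq_bigr => j _; apply: eq_bigr => i _; rewrite exprMn -!exprM.
  by congr (_ * x ^+ _); lia.
move: IB IC IC'; set B := \prod_(j < N) (1 - _); set B' := \prod_(j < N) \sum_(i < _) _.
set C := \prod_(j < N) (1 - _); set C' := \prod_(j < N) \sum_(i < _) _.
set E := \prod_(j < N) (1 - _); set E' := \prod_(j < N) \sum_(i < _) _.
move=> IB IC IE Eg.
(* Division is replaced by multiplication with the inverses [B'], [C'], [E']; the factor [E],
   present on both sides of [Eg], cancels through [E']. *)
transitivity (B * (C * E) * g * B' * C' * E').
  transitivity ((B * B') * (C * C') * (E * E') * g); last by ring.
  by rewrite IB IC IE !mul1r.
rewrite Eg; transitivity (PA * PD * B' * C' * (E * E')); first by ring.
by rewrite IE mulr1.
Qed.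

End Levels.

(** * Extracting coefficients modulo X^(n+1) *)

Lemma coef_in_qpoly_Xn (A : comNzRingType) n (p r : {poly A}) :
  in_qpoly ('X^(n.+1)) p = in_qpoly ('X^(n.+1)) r -> p`_n = r`_n.
Proof.
move/(congr1 val) => /=; rewrite mk_monic_Xn => Epr.
have E (u : {poly A}) : u`_n = (Pdiv.Ring.rmodp u 'X^(n.+1))`_n.
  rewrite {1}(Pdiv.RingMonic.rdivp_eq (monicXn A n.+1) u).
  by rewrite coefD coefMXn ltnSn add0r.
by rewrite E Epr -E.
Qed.

(** The sum is polynomial in the weights; this carries it from polynomials to the quotient, where x
    is nilpotent. *)
Lemma rmorph_tails (R R' : comNzRingType) (f : {rmorphism R -> R'}) x a c d n L p :
  f (tails x a c d n L p) = tails (f x) (f a) (f c) (f d) n L p.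
Proof.
rewrite rmorph_sum; apply: eq_bigr => s _; rewrite /tail_weight.
case: ifP => _; last exact: rmorph0.
rewrite rmorph_prod; apply: eq_bigr => y _.
by rewrite /weight rmorphM rmorphXn; case: y.2; rewrite /= ?rmorph1.
Qed.

Lemma prod_weight (R : comNzRingType) (x a c d : R) (s : seq cpart) :
  \prod_(y <- s) weight x a c d y =
  a ^+ count (fun p => p.2 == Ca) s * c ^+ count (fun p => p.2 == Cc) s
  * d ^+ count (fun p => p.2 == Cd) s * x ^+ sumn (map fst s).
Proof.
elim: s => [|[j y] s IHs]; first by rewrite big_nil !expr0 !mulr1.
rewrite big_cons {}IHs /weight /= !exprD.
by case: y; rewrite !eq_colourE /= !(expr0, expr1); ring.
Qed.

Lemma coef4_monomial n k l m i j t e :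
  coef4 (va%:P ^+ i * vc%:P ^+ j * vd%:P ^+ t * 'X^e) n k l m
  = ((e == n) && ((i == k) && ((j == l) && (t == m))))%:R.
Proof.
have -> : va%:P ^+ i * vc%:P ^+ j * vd%:P ^+ t = (va ^+ i * vc ^+ j * vd ^+ t)%:P.
  by rewrite !polyCM !polyC_exp.
rewrite /coef4 coefCM coefXn eq_sym; case: eqP => _; last by rewrite mulr0 !coef0.
rewrite mulr1 /va /vc /vd -!polyC_exp -polyCM coefCM coefXn eq_sym.
case: eqP => _; last by rewrite mulr0 !coef0 !andbF.
rewrite mulr1 coefCM coefXn eq_sym; case: eqP => _; last by rewrite mulr0 !coef0 !andbF.
by rewrite mulr1 coefXn andbT eq_sym /= andbT.
Qed.

(* Starting below the virtual part (n + 4)_a imposes no condition. *)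
Lemma sorted_path_top n s : all (fun p : cpart => (p.1 <= n)%N) s ->
  path diff_ok (n + 4, Ca)%N s = sorted diff_ok s.
Proof.
case: s => //= -[j y] s /= /andP[le_jn _].
by rewrite /diff_ok /=; case: y; rewrite leq_add.
Qed.

(** Each admissible sequence contributes one monomial recording its size and colour counts, so the
    coefficient counts sequences. *)
Lemma coef4_tail n k l m :
  coef4 (tail 'X va%:P vc%:P vd%:P n (n + 4, Ca)%N) n k l m = Posz (A2 n k l m).
Proof.
rewrite /A2 -sum1_card big_mkcond /= (big_morph Posz PoszD (erefl _)).
rewrite /coef4 /tail /tails !coef_sum; apply: eq_bigr => s _; rewrite inE.
set t := map _ s; change (coef4 (tail_weight 'X va%:P vc%:P vd%:P (n + 4, Ca)%N t) n k l m
  = Posz (if A2_seq n k l m t then 1 else 0)%N).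
have le_t : all (fun p : cpart => (p.1 <= n)%N) t.
  by apply/allP => _ /mapP[y _ ->]; rewrite /= -ltnS.
rewrite /tail_weight /A2_seq (sorted_path_top le_t).
case: (all _ _) => /=; last by rewrite /coef4 !coef0.
case: (sorted _ _) => /=; last by rewrite /coef4 !coef0.
rewrite prod_weight coef4_monomial.
by case: ifP.
Qed.

Lemma coef_tail (A : comNzRingType) (a c d : A) n N : (n <= N)%N ->
  (tail 'X a%:P c%:P d%:P n (n + 4, Ca)%N)`_n =
  ((\prod_(j < N) (1 + a *: 'X^(4 * j + 1)))
  * (\prod_(j < N) (1 + d *: 'X^(4 * j + 3)))
  * (\prod_(j < N) \sum_(i < N.+1) 'X^(2 * j.+1 * i))
  * (\prod_(j < N) \sum_(i < N.+1) (c ^+ i) *: 'X^((4 * j + 2) * i)))`_n.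
Proof.
move=> le_nN; apply: coef_in_qpoly_Xn.
pose f : {rmorphism {poly A} -> {poly %/ 'X^(n.+1)}} := in_qpoly ('X^(n.+1)).
rewrite -![in_qpoly _ _]/(f _) rmorph_tails.
have X0 : f 'X ^+ n.+1 = 0.
  rewrite -rmorphXn; apply: val_inj => /=; rewrite mk_monic_Xn.
  by rewrite Pdiv.RingMonic.rmodpp ?monicXn.
rewrite -[tails _ _ _ _ _ _ _]/(tail _ _ _ _ _ _) (tail_product _ _ _ X0 le_nN).
rewrite 3!(rmorphM f) !(rmorph_prod f); congr (_ * _ * _ * _).
- by apply: eq_bigr => j _; rewrite rmorphD rmorph1 -mul_polyC rmorphM rmorphXn.
- by apply: eq_bigr => j _; rewrite rmorphD rmorph1 -mul_polyC rmorphM rmorphXn.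
- by apply: eq_bigr => j _; rewrite rmorph_sum; apply: eq_bigr => i _; rewrite rmorphXn.
apply: eq_bigr => j _; rewrite rmorph_sum; apply: eq_bigr => i _.
by rewrite -mul_polyC rmorphM polyC_exp !rmorphXn.
Qed.

Theorem theorem2p6 (n k l m N : nat) :
  (n <= N)%N -> Posz (A2 n k l m) = coef4 (rhs_trunc N) n k l m.
Proof. by move=> le_nN; rewrite -coef4_tail /coef4 (coef_tail _ _ _ le_nN). Qed.
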